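(* Let $a>0$. For any distribution $P_e$ of $(\mathbf{X},Y)$ with $\mathbf{X}$ in a measurable space $\mathcal{X}$ and balanced binary label $Y\in\{0,1\}$ (i.e. $P_e(Y=0)=P_e(Y=1)=1/2$), and any measurable unit-norm encoder $f:\mathcal{X}\to\mathbb{S}^1\subset\mathbb{R}^2$, $$J_e(f)\le J_\star(a):=\log(1+a/2)-\tfrac12\log(1+a).$$ Equality holds if and only if the two class-conditional second moments $\mathbf{M}_{e,0}(f)$ and $\mathbf{M}_{e,1}(f)$ are rank-one projectors onto orthogonal directions. In the environment model $P_\delta$ below, $f_C$ attains equality in every environment, so that for any finite set of training environments from this model with positive weights $w_e$ summing to one, $$\max_{f\in\mathcal{F}}J_{\mathrm{tr}}(f)=J_\star(a).$$
   Context: Coding objective. For a balanced binary distribution $P_e$ and a unit-norm encoder $f$ into $\mathbb{R}^2$, let $\mathbf{M}_{e,y}(f)=\mathbb{E}_e[f(\mathbf{X})f(\mathbf{X})^\top\mid Y=y]$ for $y\in\{0,1\}$ and $\mathbf{M}_e(f)=\tfrac12(\mathbf{M}_{e,0}(f)+\mathbf{M}_{e,1}(f))$. Then $$J_e(f)=\tfrac12\log\det(\mathbf{I}_2+a\mathbf{M}_e(f))-\tfrac14\sum_{y\in\{0,1\}}\log\det(\mathbf{I}_2+a\mathbf{M}_{e,y}(f)).$$ Environment model. For $\delta\in[0,1]$, $P_\delta$ is the law of $(\mathbf{X},Y)$ with $Y\sim\mathrm{Bernoulli}(1/2)$, $\mathbf{X}=(C,S)\in\{0,1\}^2$, $C=Y$,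 $S=Y\oplus B$ (exclusive-or), $B\sim\mathrm{Bernoulli}(\delta)$ independent of $Y$. Environment $e$ in this model has law $P_e=P_{\delta_e}$ for some $\delta_e\in[0,1]$. $\mathcal{F}$ is the set of all functions $f:\{0,1\}^2\to\mathbb{S}^1$ ($\mathbb{S}^1$ is the unit circle in $\mathbb{R}^2$). With $\mathbf{b}_0=(1,0)^\top$, $\mathbf{b}_1=(0,1)^\top$, set $f_C(c,s)=\mathbf{b}_c$. For finitely many training environments with weights $w_e$, $J_{\mathrm{tr}}(f)=\sum_e w_eJ_e(f)$. *)

(* Defs.v *)
From HB Require Import structures.
From mathcomp Require Import all_boot all_order all_algebra.
From mathcomp Require Import all_classical all_reals all_analysis.

Set Implicit Arguments.
Unset Strict Implicit.
Unset Printing Implicit Defensive.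

Import Order.TTheory GRing.Theory Num.Theory.
Import numFieldNormedType.Exports.

Local Open Scope classical_set_scope.
Local Open Scope ring_scope.

(* [`|v|] on matrices is the sup norm, so the Euclidean unit circle is
   defined by coordinates. *)
Definition unit_circle (R : realType) : set 'cV[R]_2 :=
  [set v | \sum_(i < 2) v i 0 ^+ 2 = 1].

Definition unit_norm (R : realType) (X : Type) (f : X -> 'cV[R]_2) : Prop :=
  forall x, unit_circle (f x).

(* Matrices carry no canonical measurable structure: R^2 is given its Borel
   sigma-algebra. *)
Definition borel_measurable (R : realType) (d : measure_display)
    (X : measurableType d) (f : X -> 'cV[R]_2) : Prop :=
  measurable_fun [set: X] (f : X -> g_sigma_algebraType (@open 'cV[R]_2)).

Section objective.
Context {R : realType} {d : measure_display} {X : measurableType d}.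
Implicit Types (P : probability (X * bool)%type R) (f : X -> 'cV[R]_2).

Definition label_event (y : bool) : set (X * bool) := [set xy | xy.2 = y].

Definition balanced P : Prop := forall y, P (label_event y) = (2^-1)%:E.

(* Expectation conditional on an event of positive probability. *)
Definition cond_exp P (A : set (X * bool)) (g : X * bool -> R) : R :=
  (\int[P]_(xy in A) g xy) / fine (P A).

Definition class_moment P f (y : bool) : 'M[R]_2 :=
  \matrix_(i, j)
    cond_exp P (label_event y) (fun xy => (f xy.1 *m (f xy.1)^T) i j).

Definition moment P f : 'M[R]_2 :=
  2^-1 *: (class_moment P f false + class_moment P f true).

Definition logdet (a : R) (M : 'M[R]_2) : R := ln (\det (1%:M + a *: M)).

Definition coding_objective (a : R) P f : R :=
  2^-1 * logdet a (moment P f)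
  - 4^-1 * \sum_(y : bool) logdet a (class_moment P f y).

End objective.

Definition Jstar (R : realType) (a : R) : R :=
  ln (1 + a / 2) - 2^-1 * ln (1 + a).

Definition rank_one_projector (R : realType) (M : 'M[R]_2) : Prop :=
  [/\ M^T = M, M *m M = M & \rank M = 1%N].

Definition orthogonal_ranges (R : realType) (M N : 'M[R]_2) : Prop :=
  forall u v : 'cV[R]_2, (M *m u)^T *m (N *m v) = 0.

(* (Y, B) |-> ((C, S), Y) with C = Y and S = Y xor B; the values 0 and 1 are
   [false] and [true]. *)
Definition env_map (yb : bool * bool) : (bool * bool) * bool :=
  ((yb.1, yb.1 (+) yb.2), yb.1).

Lemma measurable_env_map : measurable_fun [set: bool * bool] env_map.
Proof.
have m1 : measurable_fun [set: bool * bool] (@fst bool bool).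
  exact: measurable_fst.
apply: measurable_fun_pair => //; apply: measurable_fun_pair => //.
have m2 : measurable_fun [set: bool * bool] (@snd bool bool).
  exact: measurable_snd.
rewrite (_ : (fun _ => _) =
    (fun x : bool * bool => (x.1 && ~~ x.2) || (~~ x.1 && x.2))).
  by apply: measurable_or; apply: measurable_and => //; exact: measurable_neg.
by apply/funext => -[[] []].
Qed.

HB.instance Definition _ :=
  isMeasurableFun.Build _ _ _ _ env_map measurable_env_map.

(* [bernoulli_prob p] gives mass [p] to [true] when 0 <= p <= 1, and is a
   default probability otherwise; the product measure makes Y and B
   independent. *)
Definition env_law (R : realType) (delta : R) :
    probability ((bool * bool) * bool)%type R :=
  distribution (bernoulli_prob (2^-1 : R) \x bernoulli_prob delta)%E env_map.

Definition fC (R : realType) (x : bool * bool) : 'cV[R]_2 :=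
  delta_mx (if x.1 then 1 else 0) 0.

Definition training_objective (R : realType) (a : R) (E : finType)
    (w delta : E -> R) (f : bool * bool -> 'cV[R]_2) : R :=
  \sum_(e : E) w e * coding_objective a (env_law (delta e)) f.

Definition is_maximum (R : realType) (A : set R) (m : R) : Prop :=
  A m /\ ubound A m.

(* Main.v *)
Require Import Defs.
From HB Require Import structures.
From mathcomp Require Import all_boot all_order all_algebra.
From mathcomp Require Import all_classical all_reals all_analysis.
From mathcomp Require Import measurable_realfun ring lra.

(* A unit-norm encoder makes every second moment M a symmetric positive
   semidefinite 2x2 matrix of trace one, so det (I + a M) = 1 + a + a^2 det M
   with 0 <= det M <= 1/4.  The objective is therefore maximal when
   det M_{e,0} = det M_{e,1} = 0 and det M_e = 1/4, and only then.  For trace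
   one, det M = 0 says that M is a rank-one projector, and for two such
   projectors det M_e = 1/4 says that they are orthogonal. *)

Set Implicit Arguments.
Unset Strict Implicit.
Unset Printing Implicit Defensive.

Import Order.TTheory GRing.Theory Num.Theory.
Import numFieldNormedType.Exports.

Local Open Scope classical_set_scope.
Local Open Scope ring_scope.

(** * Coordinate formulas for two-by-two matrices *)

Lemma sum_ord2 (V : nmodType) (F : 'I_2 -> V) : \sum_(i < 2) F i = F 0 + F 1.
Proof.
by rewrite !big_ord_recl big_ord0 addr0; congr (F _ + F _); exact/val_inj.
Qed.

Lemma forall_ord2 (Q : 'I_2 -> Prop) : Q 0 -> Q 1 -> forall i, Q i.
Proof.
move=> Q0 Q1 [[|[|//]] lti].
- by rewrite (_ : Ordinal lti = 0)//; exact/val_inj.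
- by rewrite (_ : Ordinal lti = 1)//; exact/val_inj.
Qed.

Lemma det_mx2 (R : comRingType) (M : 'M[R]_2) :
  \det M = M 0 0 * M 1 1 - M 0 1 * M 1 0.
Proof.
rewrite (expand_det_row M 0) sum_ord2 /cofactor !det_mx11 !mxE /=.
rewrite expr0 mul1r expr1 mulN1r mulrN.
by congr (_ * M _ _ - _ * M _ _); exact/val_inj.
Qed.

Lemma mxtrace2 (R : comRingType) (M : 'M[R]_2) : \tr M = M 0 0 + M 1 1.
Proof. exact: sum_ord2. Qed.

(** Testing on pairs of basis vectors reads off every entry of [M^T *m N]. *)
Lemma orthogonal_rangesE (R : realType) (M N : 'M[R]_2) :
  orthogonal_ranges M N <-> M^T *m N = 0.
Proof.
split=> [MN|MN u v]; last first.
  by rewrite trmx_mul mulmxA -(mulmxA u^T) MN mulmx0 mul0mx.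
apply/matrixP => i j; have := MN (delta_mx i 0) (delta_mx j 0).
rewrite trmx_mul mulmxA -(mulmxA _ M^T) trmx_delta -rowE -colE.
by move=> /matrixP/(_ 0 0); rewrite !mxE.
Qed.

(** * Determinants of symmetric positive semidefinite matrices of trace one *)

Section density_matrices.
Variable R : realType.
Implicit Types M N : 'M[R]_2.

(** The two eigenvalues are real with sum 1, so a nonnegative product is the same as positive
    semidefiniteness. *)
Definition density_matrix M := [/\ M^T = M, \tr M = 1 & 0 <= \det M].

Lemma density_matrix_entries M : density_matrix M ->
  M 1 0 = M 0 1 /\ M 1 1 = 1 - M 0 0.
Proof.
move=> [/matrixP/(_ 0 1) + trM _]; rewrite mxE => ->; split=> //.
by rewrite -trM mxtrace2 addrAC subrr add0r.
Qed.

Lemma det_density_matrix M : density_matrix M ->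
  \det M = M 0 0 * (1 - M 0 0) - M 0 1 ^+ 2.
Proof.
by move=> /density_matrix_entries[M10 M11]; rewrite det_mx2 M10 M11 expr2.
Qed.

Lemma det_scalar_add (a : R) M :
  \det (1%:M + a *: M) = 1 + a * \tr M + a ^+ 2 * \det M.
Proof. rewrite !det_mx2 mxtrace2 !mxE/=; ring. Qed.

(** On trace-one symmetric matrices the determinant is the concave function [p - p^2 - q^2] of the
    first-row entries [p], [q]. At a midpoint it exceeds the average by a quarter of the squared
    differences of [p] and [q]. *)
Lemma midpoint_density_matrix M N : density_matrix M -> density_matrix N ->
  density_matrix (2^-1 *: (M + N)).
Proof.
move=> dM dN; have [M10 M11] := density_matrix_entries dM.
have [N10 N11] := density_matrix_entries dN.
have [_ _] := dM; have [_ _] := dN; rewrite !det_density_matrix // => detN detM.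
case: dM => tM trM _; case: dN => tN trN _; split.
- by rewrite linearZ linearD /= tM tN.
- by rewrite mxtraceZ mxtraceD trM trN; lra.
- rewrite det_mx2 !mxE M10 M11 N10 N11.
  by have := sqr_ge0 (M 0 0 - N 0 0); have := sqr_ge0 (M 0 1 - N 0 1); lra.
Qed.

Lemma det_density_matrix_le M : density_matrix M -> \det M <= 4^-1.
Proof.
move=> /det_density_matrix ->.
(* The gap [1/4 - \det M] is the sum of these two squares. *)
by have := sqr_ge0 (M 0 0 - 2^-1); have := sqr_ge0 (M 0 1); lra.
Qed.

(** By Cayley-Hamilton, [M *m M = M - \det M] times the identity, so a singular [M] is idempotent.
    Singularity then bounds the rank by 1, and the nonzero trace excludes rank 0. Conversely, an
    invertible [M] would have rank 2. *)
Lemma rank_one_projectorE M : density_matrix M ->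
  rank_one_projector M <-> \det M = 0.
Proof.
move=> dM; have [M10 M11] := density_matrix_entries dM.
have [tM trM _] := dM; split=> [[_ _ rM]|detM].
  apply/eqP; apply: contraTT isT; rewrite -unitfE -unitmxE => /mxrank_unit.
  by rewrite rM.
split=> //.
  move: detM; rewrite det_density_matrix // => detM.
  by apply/matrixP; apply: forall_ord2; apply: forall_ord2;
    rewrite !mxE sum_ord2 ?M10 ?M11; lra.
apply/anti_leq/andP; split.
  rewrite -ltnS ltn_neqAle rank_leq_row andbT.
  by rewrite -/(row_free M) row_free_unit unitmxE detM unitr0.
rewrite lt0n mxrank_eq0; apply: contra_eq_neq trM => ->.
by rewrite mxtrace0 eq_sym oner_neq0.
Qed.

(* For symmetric M and N, det (M + N) = det M + det N + tr M tr N - tr (M N),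
   so for singular M and N the midpoint has determinant 1/4 iff tr (M N) = 0. *)
Lemma orthogonal_ranges_det M N : density_matrix M -> density_matrix N ->
  \det M = 0 -> \det N = 0 ->
  orthogonal_ranges M N <-> \det (2^-1 *: (M + N)) = 4^-1.
Proof.
move=> dM dN; have [M10 M11] := density_matrix_entries dM.
have [N10 N11] := density_matrix_entries dN.
have [tM _ _] := dM; rewrite orthogonal_rangesE tM !det_density_matrix //;
  last exact: midpoint_density_matrix.
rewrite !mxE => detM detN; split=> [/matrixP MN|detMN].
  have := MN 0 0; have := MN 1 1.
  by rewrite !mxE !sum_ord2 M10 M11 N10 N11; nra.
(* This sum of squares is 1 minus four times the determinant of the midpoint. Its vanishing means
   that [N] is the identity minus [M], so [M *m N = M - M *m M], which is zero for singular [M]. *)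
have : (M 0 0 + N 0 0 - 1) ^+ 2 + (M 0 1 + N 0 1) ^+ 2 = 0 by lra.
move=> /eqP; rewrite paddr_eq0 ?sqr_ge0 // !sqrf_eq0 => /andP[/eqP h0 /eqP h1].
have N00E : N 0 0 = 1 - M 0 0 by lra.
have N01E : N 0 1 = - M 0 1 by lra.
by apply/matrixP; apply: forall_ord2; apply: forall_ord2;
  rewrite !mxE sum_ord2 ?M10 ?M11 ?N10 ?N11 N00E N01E; lra.
Qed.

End density_matrices.

(** * Sharp bounds on the log-determinants and on the objective *)

Section objective_bound.
Variables (R : realType) (a : R).
Hypothesis a_gt0 : 0 < a.
Implicit Types M N : 'M[R]_2.

Lemma logdet_density_matrix M : density_matrix M ->
  logdet a M = ln (1 + a + a ^+ 2 * \det M).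
Proof. by move=> [_ trM _]; rewrite /logdet det_scalar_add trM mulr1. Qed.

Lemma logdet_ge M : density_matrix M ->
  ln (1 + a) <= logdet a M ?= iff (\det M == 0).
Proof.
move=> dM; have [_ _ detM] := dM; rewrite logdet_density_matrix //.
have a2detM : 0 <= a ^+ 2 * \det M by rewrite mulr_ge0 // sqr_ge0.
split; first by rewrite ler_ln ?posrE; move: a_gt0; lra.
rewrite (inj_in_eq (@ln_inj R)) ?posrE; [|move: a_gt0; lra..].
by rewrite eq_sym -subr_eq0 addrAC subrr add0r mulf_eq0 sqrf_eq0 gt_eqF.
Qed.

Lemma logdet_le M : density_matrix M ->
  logdet a M <= 2 * ln (1 + a / 2) ?= iff (\det M == 4^-1).
Proof.
move=> dM; have [_ _ detM] := dM; rewrite logdet_density_matrix //.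
have detM4 := det_density_matrix_le dM.
(* At determinant 1/4 the argument of the logarithm is the square of [1 + a / 2]. *)
have -> : 2 * ln (1 + a / 2) = ln (1 + a + a ^+ 2 * 4^-1).
  rewrite mulr_natl -lnXn; last by move: a_gt0; lra.
  by congr ln; field.
have a2 : 0 < a ^+ 2 by rewrite exprn_gt0.
have a2detM : 0 <= a ^+ 2 * \det M by rewrite mulr_ge0 // ltW.
have a2detM4 : a ^+ 2 * \det M <= a ^+ 2 * 4^-1 by rewrite ler_pM2l.
split; first by rewrite ler_ln ?posrE; move: a_gt0; lra.
rewrite (inj_in_eq (@ln_inj R)) ?posrE; [|move: a_gt0; lra..].
by rewrite (inj_eq (addrI _)) (inj_eq (mulfI _)) // gt_eqF.
Qed.

(** [M] stands for the label [false] and [N] for [true]; the last sum has the order in which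
    [big_bool] expands the sum over labels. *)
Lemma coding_bound M N : density_matrix M -> density_matrix N ->
  2^-1 * logdet a (2^-1 *: (M + N)) - 4^-1 * (logdet a N + logdet a M)
    <= Jstar a ?= iff
  [&& \det M == 0, \det N == 0 & \det (2^-1 *: (M + N)) == 4^-1].
Proof.
move=> dM dN; have [leM eqM] := logdet_ge dM; have [leN eqN] := logdet_ge dN.
have [leMN eqMN] := logdet_le (midpoint_density_matrix dM dN).
(* Each determinant condition becomes equality in its own logarithmic bound. The gap to [Jstar a] is
   a combination of the three slacks with positive coefficients, so it vanishes only if each slack
   does. *)
rewrite -eqM -eqN -eqMN /Jstar; split; first lra.
apply/eqP/and3P => [?|[/eqP ? /eqP ? /eqP ?]]; last by lra.
by split; apply/eqP; lra.
Qed.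

End objective_bound.

(** * Second moments of a unit-norm encoder conditional on the label *)

Section class_moments.
Context {R : realType} {d : measure_display} {X : measurableType d}.
Variables (P : probability (X * bool)%type R) (f : X -> 'cV[R]_2).
Hypotheses (balP : balanced P) (mf : borel_measurable f) (uf : unit_norm f).

Lemma unit_norm2 x : f x 0 0 ^+ 2 + f x 1 0 ^+ 2 = 1.
Proof. by have := uf x; rewrite /unit_circle /= sum_ord2. Qed.

(** Open intervals generate the Borel sets of the line, and their preimages under a continuous
    coordinate are open in the plane. *)
Lemma measurable_coord i : measurable_fun [set: X] (fun x => f x i 0).
Proof.
apply: (measurability _ (RGenOpens.measurableE R)) => _ [_ [a [b ->] <-]].
rewrite setTI; have := @mf measurableT
  ((fun v : 'cV[R]_2 => v i 0) @^-1` `]a, b[).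
rewrite setTI; apply.
apply: sub_sigma_algebra.
apply: open_comp; last exact: interval_open.
by move=> v _; exact: coord_continuous.
Qed.

Lemma measurable_label_event y : measurable (label_event y : set (X * bool)).
Proof.
rewrite [X in measurable X](_ : _ = setT `&` (@snd X bool) @^-1` [set y]).
  exact: measurable_snd.
by rewrite setTI.
Qed.

Lemma norm_coord_le1 x i : `|f x i 0| <= 1.
Proof.
have := unit_norm2 x; rewrite -(expr_le1 (n := 2)) // real_normK ?num_real //.
move: i; apply: forall_ord2 => h.
- by have := sqr_ge0 (f x 1 0); lra.
- by have := sqr_ge0 (f x 0 0); lra.
Qed.

Lemma integrable_coordM y i j :
  P.-integrable (label_event y) (EFin \o (fun xy => f xy.1 i 0 * f xy.1 j 0)).
Proof.
apply: measurable_bounded_integrable.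
- exact: measurable_label_event.
- rewrite (le_lt_trans (probability_le1 _ _)) ?ltry //.
  exact: measurable_label_event.
- by apply: measurable_funTS; apply: measurable_funM;
    apply: (measurableT_comp (measurable_coord _)); exact: measurable_fst.
- exists 1; split; first exact: num_real.
  move=> r r1 xy _ /=; rewrite normrM; apply: le_trans (ltW r1).
  by rewrite mulr_ile1 // norm_coord_le1.
Qed.

(** The factor 2 is the inverse of the label probability. *)
Lemma class_momentE y i j : class_moment P f y i j =
  2 * \int[P]_(xy in label_event y) (f xy.1 i 0 * f xy.1 j 0).
Proof.
rewrite mxE /cond_exp balP /= invrK mulrC; congr (_ * _).
by apply: eq_Rintegral => xy _; rewrite mxE big_ord1 mxE.
Qed.

(** The expression is the conditional expectation of the square of [s * f_0 + t * f_1], where [f_0]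
    and [f_1] are the coordinates of [f]. *)
Lemma class_moment_quadratic y (s t : R) :
  0 <= s ^+ 2 * class_moment P f y 0 0 + 2 * s * t * class_moment P f y 0 1
       + t ^+ 2 * class_moment P f y 1 1.
Proof.
have mE := @measurable_label_event y.
have iM i j c : P.-integrable (label_event y)
    (EFin \o (fun xy => c * (f xy.1 i 0 * f xy.1 j 0))).
  exact: (integrableZl mE c (integrable_coordM y i j)).
have iD g h : P.-integrable (label_event y) (EFin \o g) ->
    P.-integrable (label_event y) (EFin \o h) ->
    P.-integrable (label_event y) (EFin \o (fun xy => g xy + h xy)).
  by move=> ig ih; exact: (integrableD mE ig ih).
have : 0 <= \int[P]_(xy in label_event y)
    (s ^+ 2 * (f xy.1 0 0 * f xy.1 0 0) + 2 * s * t * (f xy.1 0 0 * f xy.1 1 0)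
     + t ^+ 2 * (f xy.1 1 0 * f xy.1 1 0)).
  apply: Rintegral_ge0 => xy _.
  by have := sqr_ge0 (s * f xy.1 0 0 + t * f xy.1 1 0); lra.
rewrite RintegralD ?RintegralD ?RintegralZl;
  try by [|exact: integrable_coordM|exact: iM|exact: iD].
by rewrite !class_momentE; lra.
Qed.

Lemma class_moment_density y : density_matrix (class_moment P f y).
Proof.
have mE := @measurable_label_event y.
have symM : (class_moment P f y)^T = class_moment P f y.
  apply/matrixP => i j; rewrite mxE !class_momentE; congr (_ * _).
  by apply: eq_Rintegral => xy _; rewrite mulrC.
(* The integrands add up to the squared norm of [f], which is 1, and the mass 1/2 of the label event
   cancels the factor 2. *)
have trM : \tr (class_moment P f y) = 1.
  rewrite mxtrace2 !class_momentE -mulrDr -RintegralD;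
    try by [|exact: integrable_coordM].
  under eq_Rintegral do rewrite -!expr2 unit_norm2.
  rewrite Rintegral_cst //.
  by rewrite [X in fine X](_ : _ = (2^-1)%:E) ?mul1r ?divff //; exact: balP.
split=> //; rewrite det_mx2.
have -> : class_moment P f y 1 0 = class_moment P f y 0 1.
  by have /matrixP/(_ 0 1) := symM; rewrite [LHS]mxE.
have M11 : class_moment P f y 1 1 = 1 - class_moment P f y 0 0.
  by move: trM; rewrite mxtrace2; lra.
have quad := class_moment_quadratic y.
(* With M = [p, q; q, r], the quadratic form of M takes the values p det M at
   (-q, p) and r det M at (r, -q); these add up to det M since p + r = 1. *)
have := quad (- class_moment P f y 0 1) (class_moment P f y 0 0).
have := quad (class_moment P f y 1 1) (- class_moment P f y 0 1).
rewrite M11; set p := class_moment P f y 0 0; set q := class_moment P f y 0 1.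
lra.
Qed.

Lemma coding_objective_bound (a : R) : 0 < a ->
  coding_objective a P f <= Jstar a /\
    (coding_objective a P f = Jstar a <->
      [/\ rank_one_projector (class_moment P f false),
          rank_one_projector (class_moment P f true)
        & orthogonal_ranges (class_moment P f false)
                            (class_moment P f true)]).
Proof.
move=> a_gt0; have d0 := class_moment_density false.
have d1 := class_moment_density true.
rewrite /coding_objective big_bool /moment.
have [leJ eqJ] := coding_bound a_gt0 d0 d1; split=> //.
have [p0 p0'] := rank_one_projectorE d0.
have [p1 p1'] := rank_one_projectorE d1.
(* Orthogonality is expressed by the midpoint determinant only for singular moments, so the two
   projector conditions are translated first. *)
have ortho := orthogonal_ranges_det d0 d1.
split=> [/eqP|[/p0 det0 /p1 det1 /(ortho det0 det1) det01]].
  rewrite eqJ => /and3P[/eqP det0 /eqP det1 /eqP det01].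
  split; [exact: p0'|exact: p1'|].
  exact/(ortho det0 det1).
by apply/eqP; rewrite eqJ det0 det1 det01 !eqxx.
Qed.

End class_moments.

(** * The binary environment model and the encoder [fC] *)

Lemma measurable_bool2 (A : set (bool * bool)) : measurable A.
Proof.
(* A subset of a finite type is a finite union of points, and each point is a measurable
   rectangle. *)
rewrite -[A]image_id -bigcup_imset1; apply: fin_bigcup_measurable => [|[b c] _].
  exact: finite_finset.
rewrite (_ : [set _] = [set b] `*` [set c]); first exact: measurableX.
by apply/seteqP; split=> [[? ?] /= [-> ->]|[? ?] /= [-> ->]].
Qed.

Section environment.
Variables (R : realType) (delta : R).

Lemma env_law_balanced : balanced (env_law delta).
Proof.
move=> y; rewrite /env_law /distribution /pushforward /=.
(* The label is the first coordinate, so the event pulls back to a rectangle and the factor of [B]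
   contributes its total mass 1. *)
have -> : env_map @^-1` label_event y = [set y] `*` [set: bool].
  by apply/seteqP; split=> -[b c] //= [].
transitivity (bernoulli_prob (2^-1 : R) [set y] * bernoulli_prob delta setT)%E.
  exact: product_measure1E.
have -> : bernoulli_prob delta setT = 1%E.
  exact: (probability_setT (bernoulli_prob delta)).
rewrite mule1.
rewrite bernoulli_probE; last by apply/andP; lra.
case: y; rewrite !diracE.
- by rewrite mem_set // memNset // mule0 mule1 adde0.
- rewrite memNset // mem_set // mule0 mule1 add0e; congr EFin.
  by rewrite /unstable.onem; lra.
Qed.

Lemma fC_unit_norm : unit_norm (@fC R).
Proof.
move=> [[] s]; rewrite /unit_circle /= sum_ord2 /fC !mxE /=;
  by rewrite expr1n expr0n ?addr0 ?add0r.
Qed.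

(** Makes the general bound applicable to every encoder of the finite model. *)
Lemma borel_measurable_bool2 (f : bool * bool -> 'cV[R]_2) : borel_measurable f.
Proof. by move=> _ B _; exact: measurable_bool2. Qed.

(** Since [C = Y], the encoder is constant on each label event, equal to a basis vector, and the
    moment is the outer product of that vector with itself. *)
Lemma class_moment_fC y : class_moment (env_law delta) (@fC R) y =
  delta_mx (if y then 1 else 0) (if y then 1 else 0).
Proof.
set k : 'I_2 := if y then 1 else 0.
have mfC := borel_measurable_bool2 (@fC R).
apply/matrixP => i j; rewrite (class_momentE (@fC R) env_law_balanced).
set g := fun xy : (bool * bool) * bool => fC R xy.1 i 0 * fC R xy.1 j 0.
have mg : measurable_fun setT g.
  by apply: measurable_funM; apply: (measurableT_comp (measurable_coord mfC _));
    exact: measurable_fst.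
pose mu := (bernoulli_prob (2^-1 : R) \x bernoulli_prob delta)%E.
have gE : {in env_map @^-1` label_event y, g \o env_map =1
    cst ((i == k)%:R * (j == k)%:R)}.
  move=> [b c] /set_mem by_; rewrite /g /k /fC /=.
  have {by_} <- : b = y := by_.
  by case: b; rewrite !mxE !andbT.
have muE : mu (env_map @^-1` label_event y) = (2^-1)%:E.
  exact: env_law_balanced.
have -> : \int[env_law delta]_(xy in label_event y) g xy =
    (i == k)%:R * (j == k)%:R * 2^-1.
  (* Change of variables along [env_map]: on the preimage of the label event the integrand is the
     constant from [gE], and that preimage has mass 1/2 by [muE]. *)
  transitivity (\int[mu]_(yb in env_map @^-1` label_event y)
      cst ((i == k)%:R * (j == k)%:R : R) yb); last first.
    rewrite Rintegral_cst; last exact: measurable_bool2.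
    by congr (_ * _); exact: (congr1 fine muE).
  rewrite -(eq_Rintegral _ gE).
  rewrite /Rintegral (integral_pushforward measurable_env_map) //.
  - exact/measurable_EFinP.
  - apply: measurable_bounded_integrable.
    + exact: measurable_bool2.
    + by rewrite [ltLHS]muE ltry.
    + exact: measurable_funTS (measurableT_comp mg measurable_env_map).
    + exists 1; split; first exact: num_real.
      move=> r r1 yb _ /=; apply: le_trans (ltW r1); rewrite normrM.
      by rewrite mulr_ile1 // norm_coord_le1 //; exact: fC_unit_norm.
  - exact: measurable_label_event.
rewrite mulrCA divff // mulr1.
by rewrite mxE -natrM mulnb.
Qed.

(** This is the equality case of the bound: the two moments are the projectors onto the two
    coordinate axes. *)
Lemma coding_objective_fC (a : R) : 0 < a ->
  coding_objective a (env_law delta) (@fC R) = Jstar a.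
Proof.
move=> a_gt0.
have bound := coding_objective_bound env_law_balanced
  (borel_measurable_bool2 (@fC R)) fC_unit_norm a_gt0.
have proj (k : 'I_2) : rank_one_projector (delta_mx k k : 'M[R]_2).
  by split; rewrite ?trmx_delta ?mul_delta_mx ?mxrank_delta.
apply/bound.2; rewrite !class_moment_fC; split=> //.
by apply/orthogonal_rangesE; rewrite trmx_delta mul_delta_mx_0.
Qed.

End environment.

Theorem lemma3p1 (R : realType) (a : R) (a_gt0 : 0 < a) :
  (forall (d : measure_display) (X : measurableType d)
      (P : probability (X * bool)%type R) (f : X -> 'cV[R]_2),
    balanced P -> borel_measurable f -> unit_norm f ->
    coding_objective a P f <= Jstar a /\
    (coding_objective a P f = Jstar a <->
      [/\ rank_one_projector (class_moment P f false),
          rank_one_projector (class_moment P f true)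
        & orthogonal_ranges (class_moment P f false)
                            (class_moment P f true)])) /\
  (forall delta : R, 0 <= delta <= 1 ->
    coding_objective a (env_law delta) (@fC R) = Jstar a) /\
  (forall (E : finType) (w delta : E -> R),
    (forall e, 0 <= delta e <= 1) ->
    (forall e, 0 < w e) -> \sum_(e : E) w e = 1 ->
    is_maximum
      [set training_objective a w delta f
        | f in [set f : bool * bool -> 'cV[R]_2 | unit_norm f]]
      (Jstar a)).

Proof.
split; [|split] => [d X P f balP mf uf|delta _|E w delta _ w_gt0 w1].
- exact: coding_objective_bound.
- exact: coding_objective_fC.
split=> [|_ [f uf <-]].
  exists (@fC R); first exact: fC_unit_norm.
  rewrite /training_objective.
  under eq_bigr do rewrite coding_objective_fC //.
  by rewrite -mulr_suml w1 mul1r.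
(* Writing [Jstar a] as its own weighted average reduces the upper bound to one inequality per
   environment. *)
rewrite -[leRHS]mul1r -w1 mulr_suml; apply: ler_sum => e _.
apply: ler_wpM2l; first exact: ltW.
exact: (coding_objective_bound (env_law_balanced (delta e))
  (borel_measurable_bool2 f) uf a_gt0).1.
Qed.
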